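(* Let $c_1=\frac{\ln 2}{1-\ln 2}$ and $c_2=\frac{1+\ln 2}{1-\ln 2}$. For every integer $d\geq 0$ let $s(d)$ be the maximum order of an $(n+d)$-piercing sequence. Then $\lfloor c_1 d\rfloor \leq s(d)$ for every integer $d\geq 0$, and $s(d)\leq c_2 d+o(d)$ as $d\to\infty$.
   Context: Let $f(n)\geq n$ be a nondecreasing infinite sequence of positive integers. A sequence $X=(x_1,x_2,\ldots,x_{f(N)})$ of real numbers in $[0,1)$ is called $f$-piercing of order $N$ (where $N$ is a positive integer) if $\{x_1,x_2,\ldots,x_{f(n)}\}\cap\left[\frac{i}{n},\frac{i+1}{n}\right)\neq\emptyset$ holds for every $n=1,2,\ldots,N$ and every $i=0,1,\ldots,n-1$. An $(n+d)$-piercing sequence is an $f$-piercing sequence for the function $f(n)=n+d$, where $d$ is a fixed nonnegative integer. It is a known fact that for each $d\geq 0$ the orders of $(n+d)$-piercing sequences are bounded, so $s(d)$ is a well-defined integer; note that $s(d)$ is the order $N$, while the corresponding sequence has length $s(d)+d$. *)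

(* Defs.v *)
From HB Require Import structures.
From mathcomp Require Import all_boot all_order all_algebra.
From mathcomp Require Import all_classical all_reals all_analysis.
Set Implicit Arguments.
Unset Strict Implicit.
Unset Printing Implicit Defensive.
Import Order.TTheory GRing.Theory Num.Theory.
Import numFieldNormedType.Exports.
Local Open Scope ring_scope.

(* The term x_k of the sequence is [tnth X j] with j = k - 1, so the condition
   (j < f n)%N selects x_1, ..., x_{f n}.  Intended for nondecreasing f with
   n <= f n, so that these f n terms exist whenever n <= N. *)
Definition piercing (R : realType) (f : nat -> nat) (N : nat)
    (X : (f N).-tuple R) : Prop :=
  [/\ (0 < N)%N,
      forall j : 'I_(f N), tnth X j \in `[0, 1[
    & forall n i : nat, (0 < n <= N)%N -> (i < n)%N ->
        exists j : 'I_(f N),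
          (j < f n)%N /\ tnth X j \in `[i%:R / n%:R, i.+1%:R / n%:R[].

Definition piercing_order (R : realType) (d N : nat) : Prop :=
  exists X : (N + d).-tuple R, piercing (f := fun n => (n + d)%N) X.

Definition max_piercing_order (R : realType) (d N : nat) : Prop :=
  piercing_order R d N /\ forall M : nat, piercing_order R d M -> (M <= N)%N.

Definition c1 (R : realType) : R := ln 2 / (1 - ln 2).

Definition c2 (R : realType) : R := (1 + ln 2) / (1 - ln 2).

(* Main.v *)
Require Import Defs.
From HB Require Import structures.
From mathcomp Require Import all_boot all_order all_algebra.
From mathcomp Require Import all_classical all_reals all_analysis.
From mathcomp Require Import zify ring lra.
Import Order.TTheory GRing.Theory Num.Theory.
Import numFieldNormedType.Exports.
Local Open Scope classical_set_scope.
Local Open Scope ring_scope.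

Set Implicit Arguments.
Unset Strict Implicit.
Unset Printing Implicit Defensive.

(** The lower bound comes from the sequence of de Bruijn and Erdos, whose terms
    are the fractional parts of log2 1, log2 3, log2 5, ...  Up to powers of 2
    its first m terms are log2 m, log2 (m + 1), ..., log2 (2 m - 1) modulo 1, so
    they leave no gap longer than log2 (1 + 1/m) < 1 / (m ln 2).  With m = n + d
    the bound 1 / (m ln 2) is at most 1 / n exactly when n (1 - ln 2) <= d ln 2,
    that is when n <= c1 d ([dbe_point_dense], [piercing_order_lower]).

    The upper bound holds in the form s(d) <= 5 d + K with a constant K, and
    ln 2 >= 2/3 gives c2 >= 5.  The argument is that of de Bruijn and
    Erdos for the largest gap.  Among the gaps left by the first m terms, each
    further term destroys at most one, so the gaps have pairwise distinct
    destruction times; if a gap which survives until the first k + d + O(1) terms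
    are placed has length at most about 1 / k, then the total length 1 of the
    gaps is at most about the sum of 1 / k over the m values k = n, n + 1, ...,
    where m = n + d + O(1).  That sum is about ln (2 + d / n), which is less than
    1 already for n about 2 d, and the argument only uses cells of order up to
    2 n + d + O(1), i.e. about 5 d.

    What replaces a bound on the gaps is the fact that they contain no cell
    [i/n', (i+1)/n').  For a single n' this only bounds a gap by 2 / n', since the
    gap may sit badly with respect to the grid.  But n' may be chosen in a window
    of bounded size: if the fractional part of n' a is at least 1 - 1/Q, then
    some grid point follows the left end a very closely, and the bound improves
    to (1 + 1/Q) / n' ([empty_gap_lt]).  Such an n' exists in every window of
    Q T + 1 consecutive integers unless a is within about 1/T of a fraction with
    denominator at most Q ([rotation_return]).  The gaps with such exceptional
    left ends have small total length ([sum_gaps_window]), because there are only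
    about Q^2 such fractions.  [gap_inequality] puts this together. *)

(** * Piercing sequences as functions on the natural numbers *)

(** Indexing by all natural numbers frees later arguments from ordinals bounded
    by the length. *)
Definition pierces (R : realType) (x : nat -> R) (d N : nat) : Prop :=
  forall n i : nat, (0 < n <= N)%N -> (i < n)%N ->
    exists2 j : nat, (j < n + d)%N & i%:R / n%:R <= x j < i.+1%:R / n%:R.

Lemma piercing_orderP (R : realType) (d N : nat) : (0 < N)%N ->
  piercing_order R d N <->
  exists2 x : nat -> R, (forall j, 0 <= x j < 1) & pierces x d N.
Proof.
move=> N0; split.
  case=> X [_ X01 hX]; exists (nth 0 X).
    move=> j; case: (ltnP j (N + d)) => jN.
      by have := X01 (Ordinal jN); rewrite in_itv /= (tnth_nth 0).
    by rewrite nth_default ?size_tuple // lexx ltr01.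
  move=> n i nN i_n; have [j [jn]] := hX n i nN i_n.
  by rewrite in_itv /= (tnth_nth 0) => hj; exists j.
case=> x x01 hx; exists [tuple x i | i < N + d]; split=> //.
  by move=> j; rewrite tnth_mktuple in_itv /=.
move=> n i nN i_n; have [j jn hj] := hx n i nN i_n.
have jN : (j < N + d)%N by lia.
by exists (Ordinal jN); rewrite tnth_mktuple in_itv.
Qed.

(** * The de Bruijn-Erdos sequence and the lower bound *)

(** The fractional part of log2 (2 k + 1). *)
Definition dbe_point (R : realType) (k : nat) : R :=
  ln k.*2.+1%:R / ln 2 - (trunc_log 2 k.*2.+1)%:R.

Lemma ln2_gt0 (R : realType) : 0 < ln 2 :> R.
Proof. by rewrite ln_gt0 // ltr1n. Qed.

Lemma ln2_lt1 (R : realType) : ln 2 < 1 :> R.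
Proof.
rewrite -[ltRHS](expRK (1 : R)) ltr_ln ?posrE ?expR_gt0 ?ltr0n //.
by have := expR_gt1Dx (oner_neq0 R); lra.
Qed.

(** Doubling an integer does not change the fractional part of its base-2
    logarithm, so only the odd part of j counts, and an odd part of some
    j <= 2 m is one of the first m odd numbers. *)
Lemma dbe_point_log2 (R : realType) (m j : nat) : (0 < j <= m.*2)%N ->
  exists2 k : nat, (k < m)%N &
    dbe_point R k = ln j%:R / ln 2 - (trunc_log 2 j)%:R.
Proof.
have [n] := ubnP j; elim: n j m => // n IH j m jn jm.
have [jodd|jev] := boolP (odd j).
  by exists j./2; [lia|rewrite /dbe_point; have -> : j./2.*2.+1 = j by lia].
have e : j = j./2.*2 by lia.
have [||k km hk] := IH j./2 m; [lia|lia|exists k => //].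
have j2 : (0 < j./2)%N by lia.
rewrite hk [in RHS]e trunc_log2_double // -muln2 natrM lnM ?posrE ?ltr0n //.
by rewrite mulrDl divff ?gt_eqF ?ln2_gt0 // -natr1; ring.
Qed.

Lemma dbe_point_itv (R : realType) (k : nat) : 0 <= dbe_point R k < 1.
Proof.
have [] := andP (@trunc_log_bounds 2 k.*2.+1 isT isT).
set e := trunc_log _ _ => h1 h2.
have l2 := ln2_gt0 R.
rewrite /dbe_point -/e subr_ge0 ltrBlDr ler_pdivlMr // ltr_pdivrMr //.
rewrite nat1r ![_%:R * ln 2]mulr_natl -!lnXn ?ltr0n // -!natrX.
by rewrite ler_ln ?ltr_ln ?posrE ?ltr0n ?expn_gt0 // ler_nat ltr_nat h1 h2.
Qed.

(** Scale 2 ^ a by a power of 2 to some A in [m, 2 m), and let j <= A + 1 be the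
    next integer above A.  Multiplying A by 2 ^ h adds more than
    A h ln 2 >= m h ln 2 >= 1, so j < A 2 ^ h and log2 j has the right
    fractional part. *)
Lemma dbe_point_dense (R : realType) (m : nat) (a h : R) :
  0 <= a -> 0 < h -> a + h <= 1 -> 1 <= m%:R * h * ln 2 ->
  exists2 k : nat, (k < m)%N & a <= dbe_point R k < a + h.
Proof.
move=> a0 h0 ah hm; have l2 := ln2_gt0 R.
have m0 : (0 < m)%N.
  by case: m hm => // ; rewrite !mul0r ler10.
have E2 (t : R) e : expR ((t + e%:R) * ln 2) = expR (t * ln 2) * 2 ^+ e.
  by rewrite mulrDl expRD expRM_natl lnK // posrE ltr0n.
have E1 : expR (1 * ln 2) = 2 :> R by rewrite mul1r lnK // posrE ltr0n.
(* The case distinction in the choice of e: for e = trunc_log 2 m the scaled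
   value is only known to be between m / 2 and 2 m. *)
have [e he] : exists e : nat, m%:R <= expR ((a + e%:R) * ln 2) < m%:R * 2.
  have [] := andP (@trunc_log_bounds 2 m isT m0).
  set E := trunc_log _ _ => h1 h2.
  have b2 : 2 ^+ E <= (m%:R : R) < 2 ^+ E.+1.
    by rewrite -(natrX R 2 E) -(natrX R 2 E.+1) ler_nat ltr_nat h1 h2.
  have b1 : 1 <= expR (a * ln 2) < 2.
    rewrite -[ltRHS]E1 ltr_expR ltr_pM2r // -[leLHS]expR0 ler_expR.
    by rewrite mulr_ge0 ?(ltW l2) //=; clear -ah h0; lra.
  move: b1 b2; rewrite exprS; set A := expR _; set P := 2 ^+ E => b1 b2.
  case: (leP m%:R (A * P)) => hc; [exists E | exists E.+1]; rewrite E2 ?exprS -/A -/P.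
    by rewrite hc /=; nra.
  by nra.
set A := expR _ in he.
have A0 : 0 < A by exact: expR_gt0.
have /andP [t1 t2] := truncn_itv (ltW A0).
set j := (Num.truncn A).+1.
have tm : (Num.truncn A < m.*2)%N.
  by rewrite truncn_lt_nat ?(ltW A0) // -muln2 natrM; case/andP: he.
have [k km hk] := @dbe_point_log2 R m j (tm : (0 < j <= _)%N).
exists k => //; rewrite hk.
have Aj : A < j%:R by [].
have jA : j%:R < expR ((a + h + e%:R) * ln 2).
  have -> : (a + h + e%:R) * ln 2 = (a + e%:R) * ln 2 + h * ln 2 by ring.
  rewrite expRD -/A /j -natr1.
  have := expR_gt1Dx (lt0r_neq0 (mulr_gt0 h0 l2)).
  case/andP: he => he _.
  set H := expR (h * ln 2) => hH.
  have : 1 <= A * (h * ln 2).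
    by apply: le_trans hm _; rewrite -mulrA ler_wpM2r // ltW // mulr_gt0.
  nra.
have L1 : (a + e%:R) * ln 2 < ln j%:R.
  by rewrite -[ltLHS]expRK ltr_ln ?posrE ?expR_gt0.
have L2 : ln j%:R < (a + h + e%:R) * ln 2.
  by rewrite -[ltRHS]expRK ltr_ln ?posrE ?expR_gt0.
(* Here a + h <= 1 is needed: log2 j stays in the unit interval above e. *)
have -> : trunc_log 2 j = e.
  apply: trunc_log_eq => //; rewrite -(ler_nat R) -(ltr_nat R) !natrX.
  apply/andP; split.
    have -> : 2 ^+ e = expR ((0 + e%:R) * ln 2) :> R by rewrite E2 mul0r expR0 mul1r.
    apply: le_trans (ltW Aj); rewrite ler_expR ler_pM2r //; lra.
  apply: lt_le_trans jA _.
  have -> : 2 ^+ e.+1 = expR ((1 + e%:R) * ln 2) :> R by rewrite E2 E1 exprS.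
  by rewrite ler_expR ler_pM2r //; lra.
have lm : a + e%:R < ln j%:R / ln 2 < a + h + e%:R.
  by rewrite ltr_pdivlMr // ltr_pdivrMr // L1 L2.
by clear -lm; lra.
Qed.

Lemma piercing_order_lower (R : realType) (d N : nat) :
  (0 < N)%N -> N%:R <= c1 R * d%:R -> piercing_order R d N.
Proof.
move=> N0 Nc; apply/piercing_orderP => //; exists (dbe_point R).
  exact: dbe_point_itv.
have l2 := ln2_gt0 R; have l1 := ln2_lt1 R.
move=> n i /andP[n0 nN] i_n.
have n0R : 0 < n%:R :> R by rewrite ltr0n.
have e : i.+1%:R / n%:R = i%:R / n%:R + n%:R^-1 :> R by rewrite -natr1 mulrDl mul1r.
rewrite e; apply: dbe_point_dense; rewrite ?invr_gt0 //.
  by rewrite -e ler_pdivrMr // mul1r ler_nat.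
rewrite mulrAC ler_pdivlMr // mul1r natrD.
have nN' : n%:R <= N%:R :> R by rewrite ler_nat.
have := le_trans nN' Nc; rewrite /c1 mulrAC ler_pdivlMr ?subr_gt0 // => h.
by clear -h; lra.
Qed.

(** * Gaps without a full cell *)

(** When n a is at most delta below the integer z + 1, a cell of order n
    starts at most delta / n after a, and a gap of length (1 + delta) / n would
    contain that cell.  The bound is stated with k <= n so that n can be chosen
    afterwards in a window above k. *)
Lemma empty_gap_lt (R : realType) (x : nat -> R) (d N : nat)
    (a b delta : R) (k n z : nat) :
  pierces x d N -> 0 <= delta -> b <= 1 -> (0 < k)%N -> (k <= n <= N)%N ->
  z.+1%:R - delta <= n%:R * a < z.+1%:R ->
  (forall j, (j < n + d)%N -> ~~ (a < x j < b)) ->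
  b - a < (1 + delta) / k%:R.
Proof.
move=> hx dl0 b1 k0 /andP[kn nN] /andP[az1 az2] hempty.
rewrite ltNge; apply/negP => hba.
have n0 : (0 < n)%N by lia.
have n0R : 0 < n%:R :> R by rewrite ltr0n.
have knR : k%:R <= n%:R :> R by rewrite ler_nat.
have k0R : 0 < k%:R :> R by rewrite ltr0n.
have hb : z.+2%:R <= n%:R * b.
  have h1 : 1 + delta <= k%:R * (b - a).
    by rewrite mulrC -ler_pdivrMr.
  have h2 : k%:R * (b - a) <= n%:R * (b - a).
    apply: ler_wpM2r => //; apply: le_trans hba.
    by rewrite divr_ge0 ?addr_ge0 // ltW.
  by rewrite -natr1; lra.
have zn : (z.+1 < n)%N.
  rewrite -(ler_nat R); apply: (le_trans hb).
  by rewrite -[leRHS]mulr1 ler_pM2l.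
have [j jn /andP[j1 j2]] := hx n z.+1 (introT andP (conj n0 nN)) zn.
move/negP: (hempty j jn); apply; apply/andP; split.
  by apply: lt_le_trans j1; rewrite ltr_pdivlMr // mulrC.
by apply: (lt_le_trans j2); rewrite ler_pdivrMr // mulrC.
Qed.

(** * Multiples of a number just below an integer *)

(** Adding q to n moves n alpha modulo 1 by the small step q alpha - p.  Steps of
    size at most delta cannot jump over the window [1 - delta, 1), and T steps of
    size at least 1/T go once around the circle. *)
Lemma rotation_visit (R : realType) (alpha delta : R) (q p T k : nat) :
  0 <= alpha -> (0 < T)%N ->
  T%:R^-1 <= `|q%:R * alpha - p%:R| <= delta ->
  exists n z : nat, (k <= n <= k + q * T)%N /\
    z.+1%:R - delta <= n%:R * alpha < z.+1%:R.
Proof.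
move=> a0 T0 /andP[]; set theta := q%:R * alpha - p%:R => th1 th2.
have T0R : 0 < T%:R :> R by rewrite ltr0n.
have hT : 1 <= T%:R * `|theta| by rewrite mulrC -ler_pdivrMr // mul1r.
have /andP[z1 z2] := truncn_itv (mulr_ge0 (ler0n R k) a0).
set z0 := Num.truncn _ in z1 z2.
have shift (j : nat) : (k + q * j)%:R * alpha
    = k%:R * alpha + j%:R * theta + (j * p)%:R.
  by rewrite /theta natrD !natrM; ring.
have [th0|th0] := lerP 0 theta.
  (* Steps upwards: stop at the first entry into the window. *)
  rewrite ger0_norm // in th1 th2 hT.
  have ex : exists j, z0.+1%:R - delta <= k%:R * alpha + j%:R * theta.
    by exists T; rewrite -natr1; lra.
  case: (ex_minnP ex) => j hj jmin.
  have jT : (j <= T)%N by apply: jmin; rewrite -natr1; lra.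
  exists (k + q * j)%N, (z0 + j * p)%N; split.
    by rewrite leq_addr leq_add2l leq_mul2l jT orbT.
  rewrite shift -addSn natrD; apply/andP; split; first by lra.
  rewrite ltrD2r; case: j {jT} hj jmin => [|j] hj jmin; first by lra.
  have := contraNN (jmin j); rewrite ltnn => /(_ isT).
  by rewrite -ltNge -[j.+1%:R]natr1; lra.
(* Steps downwards: stop when the integer z0 is first crossed. *)
rewrite ltr0_norm // in th1 th2 hT.
have ex : exists j, k%:R * alpha + j%:R * theta < z0%:R.
  by exists T; rewrite -natr1 in z2; lra.
case: (ex_minnP ex) => j hj jmin.
have jT : (j <= T)%N by apply: jmin; rewrite -natr1 in z2; lra.
case: j jT hj jmin => [|j] jT hj jmin; first by lra.
have hlo : z0%:R - delta <= k%:R * alpha + j.+1%:R * theta.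
  have := contraNN (jmin j); rewrite ltnn => /(_ isT).
  by rewrite -leNgt -[j.+1%:R]natr1; lra.
have zpos : (0 < z0 + j.+1 * p)%N.
  rewrite -(ltr_nat R) natrD; apply: (@le_lt_trans _ _ ((k + q * j.+1)%:R * alpha)).
    by rewrite mulr_ge0.
  by rewrite shift ltrD2r.
exists (k + q * j.+1)%N, (z0 + j.+1 * p).-1; split.
  by rewrite leq_addr leq_add2l leq_mul2l jT orbT.
by rewrite prednK // shift natrD; lra.
Qed.

(** Pigeonhole: two of the Q + 1 fractional parts of 0, alpha, ..., Q alpha lie in
    the same of Q equal subintervals of [0, 1). *)
Lemma dirichlet_approx (R : realType) (alpha : R) (Q : nat) :
  0 <= alpha < 1 -> (0 < Q)%N ->
  exists q p : nat, [/\ (0 < q <= Q)%N, (p <= q)%N &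
    `|q%:R * alpha - p%:R| < Q%:R^-1].
Proof.
case: Q => // Q /andP[a0 a1] _.
pose z (i : nat) := Num.truncn (i%:R * alpha).
have hz i : (z i)%:R <= i%:R * alpha < (z i).+1%:R.
  by apply: truncn_itv; rewrite mulr_ge0.
pose u i := Q.+1%:R * (i%:R * alpha - (z i)%:R).
have u0 i : 0 <= u i.
  by rewrite mulr_ge0 // subr_ge0; case/andP: (hz i).
have uQ i : (Num.truncn (u i) < Q.+1)%N.
  rewrite truncn_lt_nat // /u -[ltRHS]mulr1 ltr_pM2l ?ltr0n //.
  by case/andP: (hz i); rewrite -natr1; lra.
pose f (i : 'I_Q.+2) : 'I_Q.+1 := Ordinal (uQ i).
have : ~~ injectiveb f.
  by apply/negP => /injectiveP /leq_card; rewrite !card_ord ltnn.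
case/injectivePn => i0 [j0 ij0 fij0].
have [i [j [ij jQ fij]]] : exists i j : nat,
    [/\ (i < j)%N, (j < Q.+2)%N & Num.truncn (u i) = Num.truncn (u j)].
  have e : Num.truncn (u i0) = Num.truncn (u j0) by have := congr1 val fij0.
  have [h|h|h] := ltngtP i0 j0.
  - by exists i0, j0.
  - by exists j0, i0.
  - by move: ij0; rewrite (val_inj h) eqxx.
have zij : (z i <= z j)%N.
  by apply: le_truncn; rewrite ler_wpM2r // ler_nat ltnW.
have close : `|(j - i)%:R * alpha - (z j - z i)%:R| < Q.+1%:R^-1.
  have /andP[h1 h2] := truncn_itv (u0 i).
  have /andP[h3 h4] := truncn_itv (u0 j).
  rewrite -fij in h3 h4.
  have Q0 : 0 < Q.+1%:R :> R by rewrite ltr0n.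
  have -> : (j - i)%:R * alpha - (z j - z i)%:R = (u j - u i) / Q.+1%:R.
    by rewrite /u !natrB // ?(ltnW ij) //; field; rewrite gt_eqF.
  rewrite normrM [`|_^-1|]gtr0_norm ?invr_gt0 // -[ltRHS]mul1r ltr_pM2r ?invr_gt0 //.
  by rewrite ltr_norml; rewrite -natr1 in h2 h4; lra.
exists (j - i)%N, (z j - z i)%N; split=> //; first by lia.
rewrite -ltnS -(ltr_nat R) -natr1.
move: close; rewrite ltr_norml => /andP[c1 _].
have h1 : Q.+1%:R^-1 <= 1 :> R by rewrite invf_le1 ?ltr0n // ler1n.
have h2 : (j - i)%:R * alpha <= (j - i)%:R by rewrite ler_piMr // ltW.
move: c1 h1 h2.
by move: ((j - i)%:R * alpha) (z j - z i)%:R (j - i)%:R (_^-1) => A B C D *; lra.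
Qed.

(** A Dirichlet approximation q alpha - p is at most 1/Q in size, and at least 1/T
    by assumption, hence is an admissible step of the rotation. *)
Lemma rotation_return (R : realType) (alpha : R) (Q T k : nat) :
  0 <= alpha < 1 -> (0 < Q)%N -> (0 < T)%N ->
  (forall q p : nat, (0 < q <= Q)%N -> (p <= Q)%N ->
     T%:R^-1 <= `|q%:R * alpha - p%:R|) ->
  exists n z : nat, (k <= n <= k + Q * T)%N /\
    z.+1%:R - Q%:R^-1 <= n%:R * alpha < z.+1%:R.
Proof.
move=> a01 Q0 T0 hgood.
have [q [p [qQ pq close]]] := dirichlet_approx a01 Q0.
have pQ : (p <= Q)%N by lia.
have h : T%:R^-1 <= `|q%:R * alpha - p%:R| <= Q%:R^-1.
  by rewrite hgood //= ltW.
have a0 : 0 <= alpha by case/andP: a01.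
have [n [z [hn hz]]] := @rotation_visit R alpha _ q p T k a0 T0 h.
exists n, z; split=> //.
have qT : (q * T <= Q * T)%N by rewrite leq_mul2r; lia.
lia.
Qed.

(** * Summing gaps *)

(** All gaps in question lie in the window [u, v + w]; clamping y to that window
    turns the sum into part of a telescoping one. *)
Lemma sum_gaps_window (R : realType) (y : nat -> R) (L : nat) (u v w : R) :
  u <= v -> 0 <= w ->
  (forall i, (i < L)%N -> y i <= y i.+1) ->
  (forall i, (i < L)%N -> u <= y i <= v -> y i.+1 - y i <= w) ->
  \sum_(0 <= i < L | u <= y i <= v) (y i.+1 - y i) <= v - u + w.
Proof.
move=> uv w0 ymono ygap.
pose phi z : R := Num.max u (Num.min z (v + w)).
have phi_mono a b : a <= b -> phi a <= phi b.
  rewrite /phi => ab; rewrite ge_max le_max lexx /= le_max.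
  by rewrite [X in _ || X]le_min !ge_min ab lexx !orbT.
have phi_le a : u <= phi a <= v + w.
  by rewrite /phi le_max lexx /= ge_max ge_min lexx orbT andbT; lra.
apply: (@le_trans _ _ (phi (y L) - phi (y 0%N))); last first.
  by have := phi_le (y L); have := phi_le (y 0%N); lra.
rewrite -(@telescope_sumr _ 0 L (phi \o y)) // big_mkcond /=.
apply: ler_sum_nat => i /andP[_ iL]; case: ifP => hi; last first.
  by rewrite subr_ge0; apply/phi_mono/ymono.
have := ygap i iL hi; have := ymono i iL; case/andP: hi => h1 h2 h3 h4.
rewrite /phi (min_l (_ : y i <= _)) ?(min_l (_ : y i.+1 <= _)); [|lra|lra].
by rewrite !max_r; lra.
Qed.

(** The value t i = M encodes that i is never hit, so it may be repeated;
    but 1/M is below all terms of the sum on the right, whose range has at least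
    one term for each element of I.  Subtracting 1/M everywhere makes the
    repeated terms vanish. *)
Lemma sum_inv_distinct (R : realType) (I : finType) (P : pred I)
    (t : I -> nat) (n M : nat) :
  (0 < n)%N -> (n + #|I| <= M)%N ->
  (forall i, (n <= t i <= M)%N) ->
  (forall i j, (t i < M)%N -> t i = t j -> i = j) ->
  \sum_(i | P i) (t i)%:R^-1 <= \sum_(n <= k < M) k%:R^-1 :> R.
Proof.
move=> n0 IM tnM tinj.
pose c k : R := k%:R^-1 - M%:R^-1.
have M0 : 0 < M%:R :> R by rewrite ltr0n; lia.
have split_t i : (t i)%:R^-1 = M%:R^-1 + \sum_(n <= k < M | k == t i) c k.
  have /andP[nt tM] := tnM i.
  have [tM'|Mt] := ltnP (t i) M.
    by rewrite big_nat1_eq nt tM' /= /c; ring.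
  rewrite big_nat_cond big1 ?addr0; first by congr (_%:R^-1); lia.
  by move=> k hk; exfalso; lia.
rewrite (eq_bigr _ (fun i _ => split_t i)) big_split /=.
have -> : \sum_(n <= k < M) k%:R^-1 = (M - n)%:R / M%:R + \sum_(n <= k < M) c k :> R.
  rewrite /c sumrB sumr_const_nat -mulr_natl; ring.
apply: lerD.
  rewrite sumr_const -[_^-1 *+ _]mulr_natl ler_pM2r ?invr_gt0 // ler_nat.
  by have := max_card P; lia.
under eq_bigr => i _ do rewrite big_mkcond.
rewrite exchange_big /=; apply: ler_sum_nat => k /andP[nk kM].
have c0 : 0 <= c k.
  rewrite subr_ge0 lef_pV2 ?posrE ?ltr0n ?ler_nat; lia.
rewrite -big_mkcondr sumr_const -[leRHS]mulr1n; apply: ler_wpMn2l => //.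
apply/card_le1_eqP => i j; rewrite !unfold_in => /andP[_ /eqP ki] /andP[_ /eqP kj].
by apply: tinj; lia.
Qed.

(** * The total length of the gaps *)

(** The three terms on the right bound the part of [0, 1) before the first point,
    the gaps whose left end is close to a fraction p/q with q <= Q (one window of
    length 2/T plus one last gap for each of the Q (Q + 1) pairs), and all the
    other gaps, each bounded through its destruction time.  A term Q T is added to
    the number m of initial points, and again to N, because the bound for a gap
    surviving until time tau uses some order n' with
    tau - d - Q T <= n' <= tau - d. *)
Lemma gap_inequality (R : realType) (x : nat -> R) (d N Q T n : nat) :
  (forall j, 0 <= x j < 1) -> pierces x d N ->
  (0 < Q)%N -> (0 < T)%N -> (0 < n)%N ->
  (2 * n + d + 2 * (Q * T) <= N)%N ->
  1 <= n%:R^-1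
     + (Q * Q.+1)%:R * (2 / T%:R + 2 / n%:R)
     + (1 + Q%:R^-1) * \sum_(n <= k < 2 * n + d + Q * T) k%:R^-1 :> R.
Proof.
move=> x01 hx Q0 T0 n0 hN.
pose S := (Q * T)%N; pose m := (n + d + S)%N; pose M := (n + m)%N.
have EM : (2 * n + d + Q * T = M)%N by rewrite /M /m /S; lia.
have MN : (M + S <= N)%N by move: hN; rewrite /M /m /S; lia.
rewrite EM; clear hN EM.
(* The distinct values among the first m terms, in increasing order; the default
   value 1 makes y L = 1, which closes the last gap. *)
pose s := sort <=%O (undup (mkseq x m)); pose L := size s.
pose y i := nth 1 s i.
have s_lt : sorted <%O s by rewrite sort_lt_sorted undup_uniq.
have mem_s z : z \in s = (z \in mkseq x m) by rewrite mem_sort mem_undup.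
have Lm : (L <= m)%N.
  by rewrite /L size_sort (leq_trans (size_undup _)) // size_mkseq.
have y_s i : (i < L)%N -> exists2 j, (j < m)%N & y i = x j.
  move=> iL; have : y i \in mkseq x m by rewrite -mem_s mem_nth.
  by case/mapP => j; rewrite mem_iota => /andP[_ jm] ->; exists j.
have y01 i : (i < L)%N -> 0 <= y i < 1 by move=> /y_s[j _ ->].
have yL i : (L <= i)%N -> y i = 1 by move=> iL; rewrite /y nth_default.
have y_homo i j : (i < j)%N -> (i < L)%N -> y i < y j.
  move=> ij iL; have [jL|Lj] := ltnP j L.
    by rewrite /y lt_sorted_ltn_nth.
  by rewrite (yL j) //; case/andP: (y01 i iL).
have s_y j : (j < m)%N -> exists2 i, (i < L)%N & x j = y i.
  move=> jm; have : x j \in s by rewrite mem_s map_f // mem_iota.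
  by move=> /(nthP 1)[i iL <-]; exists i.
have y_le1 i : y i <= 1.
  by have [iL|/yL->//] := ltnP i L; case/andP: (y01 i iL) => _ /ltW.
pose ingap i := [pred z | y i < z < y i.+1].
have gap_first i j : (i < L)%N -> (j < m)%N -> ~~ ingap i (x j).
  move=> iL jm; apply/negP => /= /andP[h1 h2].
  have [k kL e] := s_y j jm; rewrite e in h1 h2.
  have [ki|ik|ik] := ltngtP k i.
  - by have := y_homo _ _ ki kL; rewrite ltNge ltW.
  - have [ik1|e1] := leqP k i.+1.
      have e2 : k = i.+1 by lia.
      by rewrite e2 ltxx in h2.
    by have := y_homo _ _ e1 (leq_ltn_trans ik kL); rewrite ltNge ltW.
  - by rewrite ik ltxx in h1.
(* The destruction time of gap i is the index of the first term inside it; it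
   equals H if none of the first H terms is. *)
pose H := (M + S + d)%N.
pose hit i := find (ingap i) (mkseq x H).
have hitH i : (hit i <= H)%N by rewrite -[H in leqRHS](size_mkseq x) find_size.
have before_hit i j : (j < hit i)%N -> ~~ ingap i (x j).
  move=> jh; have jH := leq_trans jh (hitH i).
  by have := before_find 0 jh; rewrite nth_mkseq // => ->.
have hit_m i : (i < L)%N -> (m <= hit i)%N.
  move=> iL; rewrite leqNgt; apply/negP => hm.
  have hH : (hit i < H)%N by apply: leq_trans hm _; rewrite /H /M; lia.
  have : has (ingap i) (mkseq x H) by rewrite has_find size_mkseq.
  move/(nth_find 0); rewrite -/(hit i) nth_mkseq //.
  by apply/negP; apply: gap_first.
have hit_inj i j : (i < L)%N -> (j < L)%N -> (hit i < H)%N -> hit i = hit j -> i = j.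
  move=> iL jL hH e.
  have hi : ingap i (x (hit i)).
    have : has (ingap i) (mkseq x H) by rewrite has_find size_mkseq.
    by move/(nth_find 0); rewrite -/(hit i) nth_mkseq.
  have hj : ingap j (x (hit i)).
    have : has (ingap j) (mkseq x H) by rewrite has_find size_mkseq -/(hit j) -e.
    by move/(nth_find 0); rewrite -/(hit j) -e nth_mkseq.
  case/andP: hi => i1 i2; case/andP: hj => j1 j2.
  have [ij|ji|//] := ltngtP i j.
    have := lt_trans j1 i2; rewrite ltNge.
    have [->|ne] := eqVneq i.+1 j; first by rewrite lexx.
    by rewrite ltW // y_homo //; lia.
  have := lt_trans i1 j2; rewrite ltNge.
  have [->|ne] := eqVneq j.+1 i; first by rewrite lexx.
  by rewrite ltW // y_homo //; lia.
pose t i := (hit i - (S + d))%N.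
(* The case delta = 1 of [empty_gap_lt] needs no choice of the order. *)
have gap_any i : (i < L)%N -> y i.+1 - y i <= 2 / n%:R.
  move=> iL; apply: ltW; have /andP[yi0 _] := y01 i iL.
  have -> : 2 = 1 + 1 :> R by [].
  apply: (@empty_gap_lt _ x d N _ _ 1 n n (Num.truncn (n%:R * y i))) => //.
  - by rewrite leqnn /=; lia.
  - by rewrite -[X in X - 1]natr1 addrK; apply: truncn_itv; rewrite mulr_ge0.
  by move=> j jn; apply: gap_first => //; rewrite /m; lia.
pose near (q p i : nat) := `|q%:R * y i - p%:R| < T%:R^-1.
pose bad i := [exists q : 'I_Q, exists p : 'I_Q.+1, near q.+1 p i].
have gap_good i : (i < L)%N -> ~~ bad i -> y i.+1 - y i <= (1 + Q%:R^-1) / (t i)%:R.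
  move=> iL hgood; apply: ltW.
  have hm := hit_m i iL; have hH := hitH i.
  have tn : (n <= t i)%N by move: hm; rewrite /t /m; lia.
  have tM : (t i <= M)%N by move: hH; rewrite /t /H; lia.
  have [|k [z [hk hz]]] := @rotation_return _ (y i) Q T (t i) (y01 i iL) Q0 T0.
    move=> q p /andP[q0 qQ] pQ; rewrite leNgt; apply: contraNN hgood => hnear.
    apply/existsP; have q1 : (q.-1 < Q)%N by lia.
    exists (Ordinal q1); apply/existsP; exists (Ordinal (pQ : (p < Q.+1)%N)).
    by rewrite /near /= prednK.
  apply: (@empty_gap_lt _ x d N _ _ _ _ k z) => //.
  - by lia.
  - by rewrite /S in MN; lia.
  move=> j jk; apply: before_hit; apply: leq_trans jk _.
  by move: hk hm; rewrite /t /m /S; lia.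
have y0 : y 0%N <= n%:R^-1.
  have [||j jn /andP[_]] := hx n 0%N; [lia|lia|].
  rewrite mul1r => xj.
  have [|i iL e] := s_y j; first by rewrite /m; lia.
  rewrite e in xj; apply: le_trans (ltW xj).
  have [->|i0] := posnP i; first by rewrite lexx.
  by rewrite ltW // y_homo // (leq_ltn_trans _ iL).
have total : 1 - y 0%N = \sum_(i < L) (y i.+1 - y i).
  by rewrite -(big_mkord xpredT (fun i => y i.+1 - y i)) telescope_sumr // (yL L).
have sum_bad : \sum_(i < L | bad i) (y i.+1 - y i)
    <= (Q * Q.+1)%:R * (2 / T%:R + 2 / n%:R).
  (* A bad gap is counted once for every fraction that it is close to. *)
  apply: (@le_trans _ _ (\sum_(i < L) \sum_(q < Q) \sum_(p < Q.+1 | near q.+1 p i)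
      (y i.+1 - y i))).
    rewrite big_mkcond /=; apply: ler_sum => i _.
    have gi0 : 0 <= y i.+1 - y i by rewrite subr_ge0 ltW // y_homo.
    have inner0 (q : 'I_Q) : 0 <= \sum_(p < Q.+1 | near q.+1 p i) (y i.+1 - y i).
      by apply: sumr_ge0.
    case: ifP => [|_]; last by apply: sumr_ge0.
    case/existsP => q /existsP[p hqp].
    rewrite (bigD1 q) //= (bigD1 p) //= -addrA lerDl addr_ge0 //.
      by apply: sumr_ge0.
    by apply: sumr_ge0.
  rewrite exchange_big /=.
  have -> : (Q * Q.+1)%:R * (2 / T%:R + 2 / n%:R)
      = \sum_(q < Q) \sum_(p < Q.+1) (2 / T%:R + 2 / n%:R) :> R.
    by rewrite !sumr_const !card_ord -mulrnA mulnC mulr_natl.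
  apply: ler_sum => q _.
  under eq_bigr => i _ do rewrite big_mkcond.
  rewrite exchange_big /=; apply: ler_sum => p _.
  rewrite -big_mkcond /=.
  have q0 : 1 <= q.+1%:R :> R by rewrite ler1n.
  (* From |q y - p| < 1/T the left end lies within 1/(q T) <= 1/T of p/q. *)
  pose u : R := p%:R / q.+1%:R - T%:R^-1.
  pose v : R := p%:R / q.+1%:R + T%:R^-1.
  have Ti0 : 0 < T%:R^-1 :> R by rewrite invr_gt0 ltr0n.
  have uv : u <= v by rewrite lerD2l (le_trans _ (ltW Ti0)) // oppr_le0 ltW.
  have w0 : 0 <= 2 / n%:R :> R by rewrite divr_ge0.
  have := @sum_gaps_window _ y L u v (2 / n%:R) uv w0.
  have -> : v - u + 2 / n%:R = 2 / T%:R + 2 / n%:R by rewrite /u /v; ring.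
  move=> h; apply: le_trans (h _ _).
  - rewrite big_mkord big_mkcond [leRHS]big_mkcond /=; apply: ler_sum => i _.
    have gi0 : 0 <= y i.+1 - y i by rewrite subr_ge0 ltW // y_homo.
    case: ifP => hnear; last by case: ifP.
    suff -> : u <= y i <= v by [].
    have q00 : 0 < q.+1%:R :> R by rewrite ltr0n.
    have : `|y i - p%:R / q.+1%:R| <= T%:R^-1.
      apply: le_trans (ltW hnear).
      have -> : q.+1%:R * y i - p%:R = q.+1%:R * (y i - p%:R / q.+1%:R).
        by field; rewrite gt_eqF.
      by rewrite normrM gtr0_norm // ler_peMl.
    rewrite ler_norml /u /v.
    by move: (T%:R^-1) (p%:R / q.+1%:R) (y i) => a b c ?; lra.
  - by move=> i iL; rewrite ltW // y_homo.
  - by move=> i iL _; apply: gap_any.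
have sum_good : \sum_(i < L | ~~ bad i) (y i.+1 - y i)
    <= (1 + Q%:R^-1) * \sum_(n <= k < M) k%:R^-1.
  apply: (@le_trans _ _ (\sum_(i < L | ~~ bad i) (1 + Q%:R^-1) / (t i)%:R)).
    by apply: ler_sum => i; apply: gap_good.
  rewrite -mulr_sumr ler_pM2l ?addr_gt0 ?invr_gt0 ?ltr0n //.
  apply: (@sum_inv_distinct _ _ _ (fun i : 'I_L => t i)) => //.
  - by rewrite card_ord /M leq_add2l.
  - move=> i; have := hit_m i (ltn_ord i); have := hitH i.
    by rewrite /t /H /m; lia.
  move=> i j tiM e; apply/val_inj/(hit_inj _ _ (ltn_ord i) (ltn_ord j)).
    by move: tiM; rewrite /t /H; lia.
  have := hit_m i (ltn_ord i); have := hit_m j (ltn_ord j).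
  by move: e; rewrite /t /m; lia.
rewrite (bigID (fun i : 'I_L => bad i)) /= in total.
by have := lerD y0 (lerD sum_bad sum_good); rewrite -total addrC subrK addrA.
Qed.

(** * Numerical estimates *)

Lemma sum_inv_le_ln (R : realType) (n M : nat) : (1 < n)%N -> (n <= M)%N ->
  \sum_(n <= k < M) k%:R^-1 <= ln (M.-1%:R / n.-1%:R) :> R.
Proof.
move=> n1 nM.
have pos k : (1 < k)%N -> 0 < k.-1%:R :> R by move=> k1; rewrite ltr0n; lia.
rewrite ln_div ?posrE ?pos //; last lia.
rewrite -(@telescope_sumr _ n M (fun k => ln k.-1%:R)) //.
apply: ler_sum_nat => k /andP[nk kM] /=.
have k1 : (1 < k)%N by lia.
have k0 : 0 < k%:R :> R by rewrite ltr0n; lia.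
have e : k.-1%:R = k%:R * (1 - k%:R^-1) :> R.
  by rewrite mulrBr mulr1 divff ?gt_eqF // -[in RHS](@prednK k) ?[_.-1.+1%:R]mulrSr ?addrK //; lia.
have h : 0 < 1 - k%:R^-1 :> R by rewrite -(pmulr_rgt0 _ k0) -e pos.
rewrite e lnM ?posrE // opprD addrA subrr sub0r.
rewrite lerNr -[leRHS]expRK ler_ln ?posrE ?expR_gt0 //.
exact: expR_ge1Dx.
Qed.

(** A power of 1 + t approximates the exponential closely enough for the two
    numerical bounds below. *)
Lemma expR_ge_pow (R : realType) (t : R) (n : nat) :
  0 <= 1 + t -> (1 + t) ^+ n <= expR (t *+ n).
Proof.
move=> t0; rewrite -mulr_natl expRM_natl.
by apply: lerXn2r; rewrite ?nnegrE ?expR_ge0 // expR_ge1Dx.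
Qed.

Lemma ln2_ge (R : realType) : 2 / 3 <= ln 2 :> R.
Proof.
rewrite -[leLHS]expRK ler_ln ?posrE ?expR_gt0 ?ltr0n //.
have h := @expR_ge_pow R (- (1 / 24)) 16 ltac:(lra).
have : expR (2 / 3) * expR (- (1 / 24) *+ 16) = 1 :> R.
  by rewrite -expRD -expR0; congr expR; lra.
have E0 : 0 < expR (2 / 3) :> R by exact: expR_gt0.
have : 1 / 2 <= (1 + - (1 / 24)) ^+ 16 :> R.
  have -> : (1 + - (1 / 24)) ^+ 16 = (((((1 + - (1 / 24)) ^+ 2) ^+ 2) ^+ 2) ^+ 2) :> R.
    by rewrite -!exprM.
  by lra.
move: h E0; set A := expR (2 / 3); set B := expR _; set C := _ ^+ 16.
nra.
Qed.

Lemma ln_five_halves_le (R : realType) : ln (5 / 2) <= 24 / 25 :> R.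
Proof.
rewrite -[leRHS]expRK ler_ln ?posrE ?expR_gt0 ?divr_gt0 ?ltr0n //.
have h := @expR_ge_pow R (3 / 50) 16 ltac:(lra).
have e : 3 / 50 *+ 16 = 24 / 25 :> R by lra.
rewrite e in h; apply: le_trans h.
have -> : (1 + 3 / 50) ^+ 16 = (((((1 + 3 / 50) ^+ 2) ^+ 2) ^+ 2) ^+ 2) :> R.
  by rewrite -!exprM.
by lra.
Qed.

(** * The upper bound and the theorem *)

(** In [gap_inequality] take n about 2 d, so that the harmonic sum is at most
    ln (5/2) <= 24/25, and Q = 50, for which (1 + 1/Q) (24/25) < 98/100.  The other
    terms are at most 10201 / T once n >= T, negligible for T >= 10^6; the right
    side is then below 1. *)
Lemma piercing_order_upper (R : realType) :
  exists K : nat, forall d N : nat, piercing_order R d N -> (N <= 5 * d + K)%N.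
Proof.
have [T T0 hT] : exists2 T : nat, (0 < T)%N & T%:R^-1 <= 1 / 1000 / 1000 :> R.
  have : 0 < 1 / 1000 / 1000 :> R by lra.
  move: (1 / 1000 / 1000) => e e0.
  have T_gt := archi_boundP (ltW (etrans (invr_gt0 e) e0)).
  have TR0 : 0 < (Num.bound e^-1)%:R :> R by apply: lt_trans T_gt; rewrite invr_gt0.
  exists (Num.bound e^-1); first by rewrite -(ltr_nat R).
  by rewrite invf_ple // ltW.
exists (6 * (50 * T) + 6 + 2 * T)%N => d N hN; rewrite leqNgt; apply/negP => big.
have [|x x01 hx] := (piercing_orderP R d _).1 hN; first by lia.
pose n := (2 * d + 2 * (50 * T) + 3 + T)%N.
have n0 : (0 < n)%N by rewrite /n; lia.
have nN : (2 * n + d + 2 * (50 * T) <= N)%N by rewrite /n; lia.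
have := @gap_inequality R x d N 50 T n x01 hx isT T0 n0 nN.
rewrite leNgt => /negP; apply.
have hn : n%:R^-1 <= T%:R^-1 :> R.
  by rewrite lef_pV2 ?posrE ?ltr0n ?ler_nat /n; lia.
have hsum : \sum_(n <= k < 2 * n + d + 50 * T) k%:R^-1 <= 24 / 25 :> R.
  apply: le_trans (ln_five_halves_le R).
  apply: le_trans (sum_inv_le_ln _ _ _) _; [by rewrite /n; lia|by lia|].
  have n1 : 0 < n.-1%:R :> R by rewrite ltr0n /n; lia.
  have M1 : 0 < (2 * n + d + 50 * T).-1%:R :> R by rewrite ltr0n /n; lia.
  rewrite ler_ln ?posrE ?divr_gt0 //.
  rewrite ler_pdivrMr // mulrAC ler_pdivlMr ?ltr0n // -!natrM ler_nat /n; lia.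
rewrite natrM.
move: hT hn hsum; set a := T%:R^-1; set b := n%:R^-1; set c := \sum_(_ <= _ < _) _.
by move=> hT hn hsum; lra.
Qed.

Theorem theorem1 (R : realType) (s : nat -> nat)
    (hs : forall d : nat, max_piercing_order R d (s d)) :
  (forall d : nat, Num.floor (c1 R * d%:R) <= (s d)%:Z) /\
  (exists2 g : nat -> R,
      g =o_\oo (fun d : nat => d%:R : R) &
      forall d : nat, (s d)%:R <= c2 R * d%:R + g d).
Proof.
have l1 := ln2_lt1 R; have l2 := ln2_gt0 R; have l23 := ln2_ge R.
split=> [d|].
  have [_ smax] := hs d.
  (* Only a positive floor, the constructor Posz N.+1, needs the construction. *)
  have := floor_le (c1 R * d%:R); case: (Num.floor _) => [[|N]|N] // hN.
  by rewrite lez_nat; apply/smax/piercing_order_lower.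
have [K hK] := piercing_order_upper R.
exists (fun=> K%:R).
  apply/eqoP => e e0; near=> d.
  rewrite !ger0_norm // mulrC -ler_pdivrMr //.
  by near: d; exact: nbhs_infty_ger.
move=> d; have [sd _] := hs d.
have : (s d)%:R <= (5 * d + K)%:R :> R by rewrite ler_nat hK.
move/le_trans; apply; rewrite natrD natrM lerD2r ler_wpM2r // /c2.
by rewrite ler_pdivlMr ?subr_gt0 //; lra.
Unshelve. all: by end_near.
Qed.
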